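(* Let $n,m,T\in\mathbb{N}$, $U\subset\mathbb{R}^m$, $X_t\subseteq\mathbb{R}^n$ and $g_t:\mathbb{R}^n\to\mathbb{R}$ for $t\in\{0,\dots,T\}$, $f:\mathbb{R}^n\times\mathbb{R}^m\times\mathbb{N}\to\mathbb{R}^n$, and let $\mathcal{A}_t=\{x\in\mathbb{R}^n: g_t(x)<0\}$ for $t\in\{0,\dots,T\}$. Suppose $V:\mathbb{R}^n\times[0,T]\to\mathbb{R}$ is a value function of the MSOP associated with the tuple $\{J,f,\{X_t\}_{0\le t\le T},U,T\}$, where $J(\mathbf{u},\mathbf{x})=\max_{0\le k\le T}g_k(x(k))$. Then $$\mathcal{R}=\{x\in\mathbb{R}^n: V(x,0)<0\},$$ where $\mathcal{R}\subset\mathbb{R}^n$ is the Finite Time Horizon Maximal Invariant Set associated with $f,\{X_t\},U,T,\{\mathcal{A}_t\}$.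
   Context: **MSOP.** The Multi-Stage Optimization Problem (MSOP) associated with $\{J,f,\{X_t\}_{0\le t\le T},U,T\}$ and initial condition $x_0$ is: minimize $J(\mathbf{u},\mathbf{x})$ over $\mathbf{u}=(u(0),\dots,u(T-1))$, $\mathbf{x}=(x(0),\dots,x(T))$ subject to $x(0)=x_0$, $x(t+1)=f(x(t),u(t),t)$ and $u(t)\in U$ for $t=0,\dots,T-1$, and $x(t)\in X_t$ for $t=0,\dots,T$. **Feasible inputs.** For $s\in\{0,\dots,T-1\}$ and $x\in X_s$, $\Gamma_{x,s}:=\{u\in U:f(x,u,s)\in X_{s+1}\}$. One writes $(u(s),\dots,u(T-1))\in\Gamma_{x_0,[s,T-1]}$ if $u(t)\in\Gamma_{x(t),t}$ for all $t\in\{s,\dots,T-1\}$, where $x(s)=x_0$ and $x(k+1)=f(x(k),u(k),k)$ for $k\in\{s,\dots,T-1\}$. **Value function.** Let $J(\mathbf u,\mathbf x)=\phi_0(x(0),u(0),\phi_1(x(1),u(1),\dots\phi_T(x(T))\dots))$ be a monotonically backward separable function, i.e. with representation maps $\phi_T:X_T\to\mathbb{R}$ and $\phi_t:X_t\times U\times\mathrm{Image}\{\phi_{t+1}\}\to\mathbb{R}$ ($t=0,\dots,T-1$) satisfying $\phi_t(x,u,z)\ge\phi_t(x,u,w)$ whenever $z\ge w$ in the image set $\mathrm{Image}\{\phi_{t+1}\}$ and $(x,u)\in X_t\times U$. A function $V:\mathbb{R}^n\times[0,T]\to\mathbb{R}$ is a value function of the MSOP if $V(x,T)=\phi_T(x)$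 for all $x\in X_T$, and for all $t\in\{0,\dots,T-1\}$ and $x\in X_t$, $$V(x,t)=\inf_{u(t)\in\Gamma_{x,t},\dots,u(T-1)\in\Gamma_{x(T-1),T-1}}\phi_t(x(t),u(t),\phi_{t+1}(x(t+1),u(t+1),\dots\phi_T(x(T))\dots)),$$ where $x(t)=x$ and $x(k+1)=f(x(k),u(k),k)$ for $k\in\{t,\dots,T-1\}$. For $J(\mathbf u,\mathbf x)=\max_{0\le k\le T}g_k(x(k))$ the representation maps are $\phi_T(x)=g_T(x)$ and $\phi_i(x,u,z)=\max\{g_i(x),z\}$ for $i\in\{0,\dots,T-1\}$. **Solution map.** For $x_0\in\mathbb{R}^n$, $\mathbf{u}=(u(0),\dots,u(T-1))$ and $t\in\{0,\dots,T\}$, $\rho_f(x_0,t,\mathbf{u}):=x(t)$, where $x(0)=x_0$ and $x(k+1)=f(x(k),u(k),k)$. **FTHMIS.** The Finite Time Horizon Maximal Invariant Set is $$\mathcal{R}:=\{x_0\in\mathbb{R}^n:\ \text{there exists }\mathbf{u}\in\Gamma_{x_0,[0,T-1]}\text{ such that }\rho_f(x_0,t,\mathbf{u})\in\mathcal{A}_t\text{ for all }t\in\{0,\dots,T\}\}.$$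
   Formalization: The set {x in R^n : V(x,0)<0} is replaced by {x in X_0 : V(x,0)<0}, because a value function is constrained only on X_t and may be negative outside X_0, where the printed equality then fails. *)

(* Defs.v *)
From mathcomp Require Import all_boot all_order all_algebra.
From mathcomp Require Import all_classical all_reals all_analysis.

Set Implicit Arguments.
Unset Strict Implicit.
Unset Printing Implicit Defensive.

Import Order.TTheory GRing.Theory Num.Theory.

Local Open Scope classical_set_scope.
Local Open Scope ring_scope.

(* MathComp / MathComp-Analysis.  R^n is 'rV[R]_n.  Finite sequences are
   encoded as total functions on nat: only u(0), ..., u(T-1) of an input
   sequence, and only the indices 0, ..., T of x, X, g and A, are ever
   relevant. *)

Section Definitions.
Context {R : realType} {n m : nat}.

Local Notation state := 'rV[R]_n.
Local Notation input := 'rV[R]_m.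

(* State at time t of the trajectory with x(s) = x0 and
   x(k+1) = f(x(k), u(k), k) for k >= s; it is x0 (junk) when t < s. *)
Fixpoint trajectory (f : state -> input -> nat -> state) (s : nat)
    (x0 : state) (u : nat -> input) (t : nat) : state :=
  match t with
  | 0%N => x0
  | k.+1 => if (k < s)%N then x0 else f (trajectory f s x0 u k) (u k) k
  end.

Definition solution_map (f : state -> input -> nat -> state) (x0 : state)
    (t : nat) (u : nat -> input) : state :=
  trajectory f 0 x0 u t.

Definition feasible_input (f : state -> input -> nat -> state)
    (X : nat -> set state) (U : set input) (x : state) (s : nat) : set input :=
  [set u | U u /\ X s.+1 (f x u s)].

(* The set Gamma_{x0,[s,T-1]}.  Gamma_{x,s} is only defined for x in X_s;
   the condition X s x0 is that domain restriction at the initial state, and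
   feasibility propagates it to the later states. *)
Definition feasible_inputs (f : state -> input -> nat -> state)
    (X : nat -> set state) (U : set input) (T s : nat) (x0 : state) :
    set (nat -> input) :=
  [set u | X s x0 /\
    forall t, (s <= t < T)%N ->
      feasible_input f X U (trajectory f s x0 u t) t (u t)].

(* phi_t(x(t), u(t), phi_{t+1}(... phi_{t+k}(x(t+k)) ...)), where phiT is the
   innermost map: with t + k = T this is the tail from time t. *)
Fixpoint nested (phi : nat -> state -> input -> R -> R) (phiT : state -> R)
    (k t : nat) (u : nat -> input) (x : nat -> state) : R :=
  match k with
  | 0%N => phiT (x t)
  | k'.+1 => phi t (x t) (u t) (nested phi phiT k' t.+1 u x)
  end.

Inductive rep_image (X : nat -> set state) (U : set input) (T : nat)
    (phi : nat -> state -> input -> R -> R) (phiT : state -> R) :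
    nat -> R -> Prop :=
| RepImageLast x of X T x : rep_image X U T phi phiT T (phiT x)
| RepImageStep t x u z of (t < T)%N & X t x & U u &
    rep_image X U T phi phiT t.+1 z :
    rep_image X U T phi phiT t (phi t x u z).

(* A monotonically backward separable function J together with its
   representation maps.  The maps are total functions, but only constrained on
   X_t x U x Image(phi_{t+1}). *)
Record mbs_function (X : nat -> set state) (U : set input) (T : nat) :=
  MbsFunction {
    objective : (nat -> input) -> (nat -> state) -> R ;
    rep_last : state -> R ;
    rep_map : nat -> state -> input -> R -> R ;
    objective_nested : forall u x,
      (forall t, (t < T)%N -> U (u t)) -> (forall t, (t <= T)%N -> X t (x t)) ->
      objective u x = nested rep_map rep_last T 0 u x ;
    rep_map_monotone : forall t x u z w,
      (t < T)%N -> X t x -> U u ->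
      rep_image X U T rep_map rep_last t.+1 z ->
      rep_image X U T rep_map rep_last t.+1 w ->
      w <= z -> rep_map t x u w <= rep_map t x u z
  }.

(* The infimum is taken in the extended reals, so that inf set0 = +oo.  As V
   is real-valued, a value function exists only if every state of every X_t
   admits a feasible input sequence.  Time is a real number, and V is
   unconstrained at non-integer times. *)
Definition value_function (X : nat -> set state) (U : set input) (T : nat)
    (J : mbs_function X U T) (f : state -> input -> nat -> state)
    (V : state -> R -> R) : Prop :=
  (forall x, X T x -> V x T%:R = rep_last J x) /\
  (forall t x, (t < T)%N -> X t x ->
    (V x t%:R)%:E =
    ereal_inf [set (nested (rep_map J) (rep_last J) (T - t) t u
                      (trajectory f t x u))%:E
              | u in feasible_inputs f X U T t x]).

Definition max_objective (T : nat) (g : nat -> state -> R)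
    (u : nat -> input) (x : nat -> state) : R :=
  \big[Num.max/g 0%N (x 0%N)]_(k < T.+1) g k (x k).

Definition max_rep (g : nat -> state -> R) (t : nat) (x : state) (u : input)
    (z : R) : R :=
  Num.max (g t x) z.

Lemma max_objective_nested (T : nat) (g : nat -> state -> R) u x :
  max_objective T g u x = nested (max_rep g) (g T) T 0 u x.
Proof.
have tail k t z : (t + k)%N = T ->
    \big[Num.max/z]_(t <= i < (t + k).+1) g i (x i)
    = Num.max (nested (max_rep g) (g T) k t u x) z.
  elim: k t => [|k IH] t.
    by rewrite addn0 => <-; rewrite big_ltn// big_geq.
  rewrite addnS -addSn => tkT; rewrite big_ltn; last first.
    by rewrite ltnS addSn ltnW// ltnS leq_addr.
  by rewrite IH//= /max_rep maxA.
rewrite /max_objective -(big_mkord predT (fun k => g k (x k))).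
rewrite -[X in \big[_/_]_(_ <= _ < X.+1 | _) _]add0n tail//.
apply/max_idPl; case: {tail}T => [|T] //=.
by rewrite /max_rep le_max lexx.
Qed.

Lemma max_rep_monotone (g : nat -> state -> R) t x u z w :
  w <= z -> max_rep g t x u w <= max_rep g t x u z.
Proof. by move=> wz; rewrite /max_rep ge_max !le_max lexx wz orbT. Qed.

Definition max_mbs (X : nat -> set state) (U : set input) (T : nat)
    (g : nat -> state -> R) : mbs_function X U T :=
  @MbsFunction X U T (max_objective T g) (g T) (max_rep g)
    (fun u x _ _ => max_objective_nested T g u x)
    (fun t x u z w _ _ _ _ _ => @max_rep_monotone g t x u z w).

Definition finite_time_max_invariant_set (f : state -> input -> nat -> state)
    (X : nat -> set state) (U : set input) (T : nat) (A : nat -> set state) :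
    set state :=
  [set x0 | exists2 u, feasible_inputs f X U T 0 x0 u &
    forall t, (t <= T)%N -> A t (solution_map f x0 t u)].

End Definitions.

(* Main.v *)
Require Import Defs.
From mathcomp Require Import all_boot all_order all_algebra.
From mathcomp Require Import all_classical all_reals all_analysis.

Import Order.TTheory GRing.Theory Num.Theory.

Local Open Scope classical_set_scope.
Local Open Scope ring_scope.

(** A maximum is negative exactly when all its entries are ([nested_max_lt]), so a feasible input
    keeps the trajectory in every [A t] exactly when its cost is negative. An infimum is negative
    exactly when some element is ([value_lt]), so such an input exists exactly when [V x 0 < 0]. A
    value function is unconstrained at time 0 outside [X 0], while feasibility forces [X 0 x]; hence
    that conjunct in the theorem. *)

Lemma nested_max_lt {R : realType} {n m : nat} {g : nat -> 'rV[R]_n -> R}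
    (k t : nat) {u : nat -> 'rV[R]_m} {x : nat -> 'rV[R]_n} {c : R} :
  nested (max_rep g) (g (t + k)%N) k t u x < c <->
  forall i, (t <= i <= t + k)%N -> g i (x i) < c.
Proof.
elim: k t => [|k IH] t /=.
  rewrite addn0; split=> [gc i|]; last by apply; rewrite leqnn.
  by rewrite -eqn_leq => /eqP <-.
(* Reading the end time as [t.+1 + k] shows that the tail from [t.+1] has the same innermost map, so
   [IH] applies. *)
rewrite /max_rep gt_max addnS -addSn; split=> [/andP[gtc /IH gc] i|gc].
  by case/andP; rewrite leq_eqVlt => /predU1P[<- //|ti iT]; apply: gc; rewrite ti.
apply/andP; split; first by apply: gc; rewrite leqnn addSn leqW// leq_addr.
by apply/IH => i /andP[ti iT]; apply: gc; rewrite (ltnW ti).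
Qed.

(* The infimum need not be attained; strictness of [< c] is what lets a single
   input sequence witness the bound. *)
Lemma value_lt {R : realType} {n m T : nat} {U : set 'rV[R]_m}
    {X : nat -> set 'rV[R]_n} {J : mbs_function X U T}
    {f : 'rV[R]_n -> 'rV[R]_m -> nat -> 'rV[R]_n} {V : 'rV[R]_n -> R -> R}
    (hV : value_function J f V) {x : 'rV[R]_n} (c : R) : X 0%N x ->
  V x 0 < c <-> exists2 u, feasible_inputs f X U T 0 x u &
    nested (rep_map J) (rep_last J) T 0 u (trajectory f 0 x u) < c.
Proof.
(* The infimum formula only covers times before [T]; for [T = 0] the value comes from the terminal
   condition, and any input is vacuously feasible. *)
case: T J hV => [|T] J [VT Vinf] Xx.
  rewrite (VT x Xx) /=; split=> [Jc|[u _ //]].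
  by exists (fun=> 0) => //; split=> // t; rewrite ltn0 andbF.
have {Vinf} := Vinf 0%N x isT Xx; rewrite subn0 mulr0n => Vinf.
rewrite -lte_fin Vinf; split=> [/ereal_inf_lt[_ [u uF <-]]|[u uF Jc]].
  by rewrite lte_fin; exists u.
rewrite -lte_fin in Jc; apply: le_lt_trans Jc.
by apply: ereal_inf_lbound; exists u.
Qed.

Theorem theorem18 (R : realType) (n m T : nat) (U : set 'rV[R]_m)
    (X : nat -> set 'rV[R]_n) (g : nat -> 'rV[R]_n -> R)
    (f : 'rV[R]_n -> 'rV[R]_m -> nat -> 'rV[R]_n)
    (A : nat -> set 'rV[R]_n)
    (hA : forall t, (t <= T)%N -> A t = [set x | g t x < 0])
    (V : 'rV[R]_n -> R -> R)
    (hV : value_function (max_mbs X U T g) f V) :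
  finite_time_max_invariant_set f X U T A =
  [set x | X 0%N x /\ V x 0 < 0].
Proof.
apply/seteqP; split=> x /=.
  move=> [u uF uA]; have Xx := uF.1; split=> //.
  apply/(value_lt hV _ Xx); exists u => //.
  (* The innermost map [g T] matches [g (0 + T)] by computation. *)
  apply/(nested_max_lt T 0%N) => t tT.
  by have := uA t tT; rewrite hA.
move=> [Xx /(value_lt hV _ Xx)[u uF]].
move=> /(nested_max_lt T 0%N) gu; exists u => // t tT.
by rewrite hA//; exact: gu.
Qed.
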